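(* Let $\epsilon>0$ and let $U$ be a probability distribution over $\mathbb{R}$. If the mechanism $\mathsf{GradPerturb}$ equipped with $U$ is $(\epsilon,0)$-differentially private with respect to the label, then the protocol $\mathsf{TPSL}$ (Transcript Private Split Learning), run with $\mathsf{GradPerturb}$ equipped with $U$, is $(2\epsilon,0)$-transcript differentially private; that is, for any two neighboring datasets $D,D'$ (same features, labels differing in exactly one sample) and any (measurable) set $S$ of possible transcripts, $$\Pr[\mathsf{tran}(\mathsf{TPSL})(D)\in S]\le e^{2\epsilon}\cdot\Pr[\mathsf{tran}(\mathsf{TPSL})(D')\in S].$$
   Context: **Differential privacy.** For $\epsilon,\delta\ge 0$, a randomized mechanism $\mathcal{M}$ is $(\epsilon,\delta)$-differentially private (DP) if for all neighboring inputs $D,D'$ and every (measurable) set $S$ of possible outputs, $\Pr[\mathcal{M}(D)\in S]\le e^{\epsilon}\Pr[\mathcal{M}(D')\in S]+\delta$. A dataset is $D=(X,Y)$ with $n$ samples, features $X=(\mathbf{x}_1,\dots,\mathbf{x}_n)\in\mathcal{X}^n$ and labels $Y\in\{0,1\}^n$; two datasets are neighboring if they differ only in the label of one sample. A multi-party protocol $A$ is $(\epsilon,\delta)$-transcript DP if its transcript $\mathsf{tran}(A)$, i.e. the collection of all messages exchanged between the parties, viewed as a randomized function of the dataset, is $(\epsilon,\delta)$-DP. **GradPerturb equipped with $U$.** Input: a label $y\in\{0,1\}$ and vectors $g_0,g_1\in\mathbb{R}^m$ (any dimension $m$). It samples $u\sim U$ (fresh, independent randomness in each call) and returns $g_y+u\cdot(g_{1-y}-g_y)$.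 It is $(\epsilon,0)$-DP with respect to the label if for every $m$ and all fixed $g_0,g_1\in\mathbb{R}^m$, the mechanism $y\mapsto \mathsf{GradPerturb}(y,g_0,g_1)$ is $(\epsilon,0)$-DP, where the two labels $0$ and $1$ are neighboring. **TPSL.** There are two parties: the non-label party $P_N$, which holds $X$, and the label party $P_L$, which holds $Y$. $P_N$ holds a parametrized function $f_{\theta_N}:\mathcal{X}\to\mathbb{R}^d$ with parameter vector $\theta_N$, and $P_L$ holds a parametrized function $h_{\theta_L}:\mathbb{R}^d\to[0,1]$ with parameter vector $\theta_L$ (both are neural networks). Parameters of the protocol: number of batches $B$ (dividing $n$), step size $\eta$, loss function $\ell:[0,1]\times\{0,1\}\to\mathbb{R}_{\ge0}$, distribution $U$ over $\mathbb{R}$. All derivatives below are assumed to be well defined as measurable functions of their arguments (e.g. by the usual backpropagation convention at non-differentiable points). The samples are divided into $B$ disjoint batches of size $n/B$ independently of the labels, so that each sample is used exactly once; the $i$-th sample of batch $b$ is $(\mathbf{x}_{b,i},y_{b,i})$. The parameters $\theta_N,\theta_L$ are initialized with random Gaussian values independent of the data. Then for $b=1,2,\dots,B$, with the current $\theta_N,\theta_L$: 1. $P_N$ computes the embeddings $e_{b,i}:=f_{\theta_N}(\mathbf{x}_{b,i})$ for $i=1,\dots,n/B$ and sends $\{e_{b,i}\}_{i}$ to $P_L$. 2. For each $i=1,\dots,n/B$, $P_L$ computes $\tilde y_{b,i}:=h_{\theta_L}(e_{b,i})$ and, for each $j\in\{0,1\}$, $\ell_{b,i,j}:=\ell(\tilde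 y_{b,i},j)$, $g_{b,i,j}:=\partial\ell_{b,i,j}/\partial e_{b,i}$ and $u_{b,i,j}:=\partial\ell_{b,i,j}/\partial\theta_L$. Then $P_L$ computes $\tilde g_{b,i}:=\mathsf{GradPerturb}(y_{b,i},g_{b,i,0},g_{b,i,1})$ and $\tilde u_{b,i}:=\mathsf{GradPerturb}(y_{b,i},u_{b,i,0},u_{b,i,1})$ (two independent calls). 3. $P_L$ sends $\{\tilde g_{b,i}\}_{i}$ to $P_N$. 4. $P_L$ updates $\theta_L\leftarrow\theta_L-\eta\cdot\frac{B}{n}\sum_{i=1}^{n/B}\tilde u_{b,i}$, and $P_N$ updates $\theta_N\leftarrow\theta_N-\eta\cdot\frac{B}{n}\sum_{i=1}^{n/B}\tilde g_{b,i}^{\top}\frac{\partial e_{b,i}}{\partial\theta_N}$. The transcript is $\mathsf{tran}(\mathsf{TPSL})=\{e_{b,i}\}_{b\in[B],\,i\in[n/B]}\cup\{\tilde g_{b,i}\}_{b\in[B],\,i\in[n/B]}$ (as an indexed family). *)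

(* Defs.v *)
From HB Require Import structures.
From mathcomp Require Import all_boot all_order all_algebra.
From mathcomp Require Import all_classical all_reals all_analysis.

Set Implicit Arguments.
Unset Strict Implicit.
Unset Printing Implicit Defensive.

Import Order.TTheory GRing.Theory Num.Theory.
Import numFieldNormedType.Exports.

Local Open Scope classical_set_scope.
Local Open Scope ring_scope.

Definition measure_matrix_display : measure_display -> measure_display.
Proof. exact. Qed.

(* The product sigma-algebra, generated by the entries; on ['rV[R]_m] with
   [R : realType] it is the Borel sigma-algebra of R^m. *)
Section measurable_matrix.
Context {dT : measure_display} {T : measurableType dT} (m n : nat).

Definition entry_sets : set (set 'M[T]_(m, n)) :=
  [set A | exists i j, exists2 S : set T, measurable S &
    A = (fun M : 'M[T]_(m, n) => M i j) @^-1` S].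

Let matrix_set0 : <<s entry_sets >> set0.
Proof. exact: sigma_algebra0. Qed.

Let matrix_setC A : <<s entry_sets >> A -> <<s entry_sets >> (~` A).
Proof. exact: sigma_algebraC. Qed.

Let matrix_bigcup (F : (set 'M[T]_(m, n))^nat) :
  (forall i, <<s entry_sets >> (F i)) -> <<s entry_sets >> (\bigcup_i F i).
Proof. exact: sigma_algebra_bigcup. Qed.

HB.instance Definition _ := @isMeasurable.Build (measure_matrix_display dT)
  'M[T]_(m, n) <<s entry_sets >> matrix_set0 matrix_setC matrix_bigcup.

End measurable_matrix.

(* A mechanism is given by its random output [M x : Omega -> T] on each input
   [x]. The common probability space is immaterial, since only the law of each
   [M x] enters; measurability makes these laws meaningful. *)
Definition differentially_private (D : Type) (neighbor : D -> D -> Prop)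
    (dO dT : measure_display) (Omega : measurableType dO)
    (T : measurableType dT) (R : realType) (P : probability Omega R)
    (M : D -> Omega -> T) (eps delta : R) : Prop :=
  (forall x, measurable_fun setT (M x)) /\
  (forall x x', neighbor x x' -> forall S : set T, measurable S ->
    (P (M x @^-1` S) <= (expR eps)%:E * P (M x' @^-1` S) + delta%:E)%E).

Section grad_perturb.
Context {R : realType}.

(* [u] is the sample drawn from [U]; the label 1 is [true]. *)
Definition grad_perturb (m : nat) (y : bool) (g0 g1 : 'rV[R]_m) (u : R)
    : 'rV[R]_m :=
  let g j := if j then g1 else g0 in g y + u *: (g (~~ y) - g y).

Definition grad_perturb_label_dp (U : probability R R) (eps : R) : Prop :=
  forall (m : nat) (g0 g1 : 'rV[R]_m),
    differentially_private (fun y y' : bool => y <> y') U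
      (fun y => grad_perturb y g0 g1) eps 0.

End grad_perturb.

Record dataset (X : Type) (n : nat) :=
  Dataset { features : n.-tuple X; labels : n.-tuple bool }.

Definition neighboring (X : Type) (n : nat) (D D' : dataset X n) : Prop :=
  features D = features D' /\
  exists i, tnth (labels D) i <> tnth (labels D') i /\
    forall j, j <> i -> tnth (labels D) j = tnth (labels D') j.

Section gaussian.
Context {R : realType}.

(* [normal_prob m 0] is not a normal law in the library, whence the case
   distinction: a constant counts as normal with variance 0. *)
Definition normal_law (m s : R) : set R -> \bar R :=
  if s == 0 then \d_m else normal_prob m s.

(* A random vector is Gaussian when all its linear forms are normal. *)
Definition gaussian_vector (d : measure_display) (Omega : measurableType d)
    (P : probability Omega R) (m : nat) (V : Omega -> 'rV[R]_m) : Prop :=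
  forall a : 'rV[R]_m, exists mean s : R, forall S : set R, measurable S ->
    P [set w | S (\sum_k a 0 k * V w 0 k)] = normal_law mean s S.

Definition gradient (m : nat) (F : 'rV[R]_m -> R) (x : 'rV[R]_m) : 'rV[R]_m :=
  \row_k 'D_(delta_mx 0 k) F x.

End gaussian.

(* The derivative fields are given as functions because they carry a convention
   (e.g. backpropagation) where the derivative does not exist; at every point
   of differentiability they are forced to be the actual derivative. *)
Record split_model (R : realType) (X : Type) (d pN pL : nat) := SplitModel {
  embed : 'rV[R]_pN -> X -> 'rV[R]_d;
  head : 'rV[R]_pL -> 'rV[R]_d -> {i01 R};
  loss : {i01 R} -> bool -> {nonneg R};
  loss_at := fun (theta : 'rV[R]_pL) (e : 'rV[R]_d) (j : bool) =>
    (loss (head theta e) j)%:num;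
  dloss_de : 'rV[R]_pL -> 'rV[R]_d -> bool -> 'rV[R]_d;
  dloss_dtheta : 'rV[R]_pL -> 'rV[R]_d -> bool -> 'rV[R]_pL;
  (* entry (i, k) is the derivative of the i-th coordinate of the embedding
     along the k-th parameter *)
  dembed_dtheta : 'rV[R]_pN -> X -> 'M[R]_(d, pN);
  dloss_deE : forall theta e j,
    differentiable (fun e' : 'rV[R]_d => loss_at theta e' j) e ->
    dloss_de theta e j = gradient (fun e' => loss_at theta e' j) e;
  dloss_dthetaE : forall theta e j,
    differentiable (fun theta' : 'rV[R]_pL => loss_at theta' e j) theta ->
    dloss_dtheta theta e j =
      gradient (fun theta' => loss_at theta' e j) theta;
  (* ['J] acts on row vectors from the right, whence the transpose *)
  dembed_dthetaE : forall theta x,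
    differentiable (fun theta' : 'rV[R]_pN => embed theta' x) theta ->
    dembed_dtheta theta x = ('J (fun theta' => embed theta' x) theta)^T;
  measurable_embed : forall x,
    measurable_fun setT (fun theta => embed theta x);
  measurable_dloss_de : forall j,
    measurable_fun setT (fun te : 'rV[R]_pL * 'rV[R]_d =>
      dloss_de te.1 te.2 j);
  measurable_dloss_dtheta : forall j,
    measurable_fun setT (fun te : 'rV[R]_pL * 'rV[R]_d =>
      dloss_dtheta te.1 te.2 j);
  measurable_dembed_dtheta : forall x,
    measurable_fun setT (fun theta => dembed_dtheta theta x)
}.

(* The randomness of a run. The division into batches may be random and may
   depend on the features, but it does not see the labels; sample [i] of batch
   [b] is the sample of index [batch x w (b, i)]. *)
Record tpsl_randomness (R : realType) (X : Type) (pN pL n B : nat)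
    (dO : measure_display) (Omega : measurableType dO)
    (P : probability Omega R) (U : probability R R) := TpslRandomness {
  theta_init : {RV P >-> ('rV[R]_pN * 'rV[R]_pL)%type};
  batch : n.-tuple X -> Omega -> {ffun 'I_B * 'I_(n %/ B) -> 'I_n};
  noise_g : 'I_B -> 'I_(n %/ B) -> {RV P >-> R};
  noise_u : 'I_B -> 'I_(n %/ B) -> {RV P >-> R};
  theta_init_gaussian :
    gaussian_vector P (fun w => row_mx (theta_init w).1 (theta_init w).2);
  batch_bij : forall x w, bijective (batch x w);
  measurable_batch : forall x s, measurable [set w | batch x w = s];
  (* The noises are i.i.d. of law [U], and independent of the initialization
     and of the batches. *)
  noise_indep : forall (x : n.-tuple X)
      (s : {ffun 'I_B * 'I_(n %/ B) -> 'I_n})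
      (A : set ('rV[R]_pN * 'rV[R]_pL)%type)
      (Sg Su : 'I_B -> 'I_(n %/ B) -> set R),
    measurable A -> (forall b i, measurable (Sg b i)) ->
    (forall b i, measurable (Su b i)) ->
    P [set w | [/\ batch x w = s, A (theta_init w) &
        forall b i, Sg b i (noise_g b i w) /\ Su b i (noise_u b i w)]] =
    (P [set w | batch x w = s /\ A (theta_init w)] *
      \prod_b \prod_i (U (Sg b i) * U (Su b i)))%E
}.

Section tpsl.
Context {R : realType} {X : Type} {d pN pL n B : nat}.
Context {dO : measure_display} {Omega : measurableType dO}.
Context {P : probability Omega R} {U : probability R R}.
Variables (model : split_model R X d pN pL) (eta : R).
Variable (rnd : tpsl_randomness X pN pL n B P U).
Variables (D : dataset X n) (w : Omega).

Let k := (n %/ B)%N.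
Let state : Type := ('rV[R]_pN * 'rV[R]_pL)%type.

Definition sample_x (b : 'I_B) (i : 'I_k) : X :=
  tnth (features D) (batch rnd (features D) w (b, i)).

Definition sample_y (b : 'I_B) (i : 'I_k) : bool :=
  tnth (labels D) (batch rnd (features D) w (b, i)).

Definition embedding (b : 'I_B) (th : state) (i : 'I_k) : 'rV[R]_d :=
  embed model th.1 (sample_x b i).

Definition perturbed_g (b : 'I_B) (th : state) (i : 'I_k) : 'rV[R]_d :=
  let g := dloss_de model th.2 (embedding b th i) in
  grad_perturb (sample_y b i) (g false) (g true) (noise_g rnd b i w).

Definition perturbed_u (b : 'I_B) (th : state) (i : 'I_k) : 'rV[R]_pL :=
  let u := dloss_dtheta model th.2 (embedding b th i) in
  grad_perturb (sample_y b i) (u false) (u true) (noise_u rnd b i w).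

Definition update (th : state) (b : 'I_B) : state :=
  (th.1 - (eta * (B%:R / n%:R)) *:
     \sum_i perturbed_g b th i *m dembed_dtheta model th.1 (sample_x b i),
   th.2 - (eta * (B%:R / n%:R)) *: \sum_i perturbed_u b th i).

(* [enum 'I_B] lists the batches in increasing order. *)
Definition state_before (b : 'I_B) : state :=
  foldl update (theta_init rnd w) (take b (enum 'I_B)).

Definition tpsl_transcript
    : B.-tuple (k.-tuple 'rV[R]_d * k.-tuple 'rV[R]_d)%type :=
  [tuple ([tuple embedding b (state_before b) i | i < k],
          [tuple perturbed_g b (state_before b) i | i < k]) | b < B].

End tpsl.

(* Main.v *)
(* Each noise is used by a single call of GradPerturb, and the state in which
   that call is made does not depend on its answer. Hence, once the batches are
   fixed and everything but this one noise is frozen, the transcript is a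
   measurable post-processing of one GradPerturb answer with fixed gradients,
   and switching the label of that call costs a factor exp eps. Integrating over
   the frozen randomness, independent of that noise, keeps the factor.
   A sample occurs once in the batches, so its label is used by two calls, the
   gradient call and the parameter call: switching them one after the other
   gives exp (2 eps). *)
Require Import Defs.
From HB Require Import structures.
From mathcomp Require Import all_boot all_order all_algebra.
From mathcomp Require Import all_classical all_reals all_analysis.
From mathcomp Require Import measurable_realfun.

Set Implicit Arguments.
Unset Strict Implicit.
Unset Printing Implicit Defensive.

Import Order.TTheory GRing.Theory Num.Theory.
Import numFieldNormedType.Exports.

Local Open Scope classical_set_scope.
Local Open Scope ring_scope.

(** * Measurability of matrix-valued maps *)

Section measurable_matrix_theory.
Context {dO : measure_display} {Omega : measurableType dO}.

(** The entry sets generate the sigma-algebra of matrices, so testing preimages of these generators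
    is enough. *)
Lemma measurable_mxP (dT : measure_display) (T : measurableType dT) (m n : nat)
    (f : Omega -> 'M[T]_(m, n)) :
  measurable_fun setT f <-> forall i j, measurable_fun setT (fun w => f w i j).
Proof.
split=> [mf i j|mf].
  apply: (measurableT_comp (f := fun M : 'M[T]_(m, n) => M i j)) => // _ A mA.
  by rewrite setTI; apply: sub_sigma_algebra; exists i, j, A.
apply: (@measurability _ _ _ _ _ _ (@entry_sets _ T m n)) => //.
move=> _ [_ [i [j [A mA ->]]] <-].
exact: (mf i j measurableT A mA).
Qed.

Context {R : realType}.

Lemma measurable_mxD (m n : nat) (f g : Omega -> 'M[R]_(m, n)) :
  measurable_fun setT f -> measurable_fun setT g ->
  measurable_fun setT (fun w => f w + g w).
Proof.
move=> /measurable_mxP mf /measurable_mxP mg; apply/measurable_mxP => i j.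
under eq_fun do rewrite mxE.
exact: measurable_funD.
Qed.

Lemma measurable_mxZ (m n : nat) (c : Omega -> R) (f : Omega -> 'M[R]_(m, n)) :
  measurable_fun setT c -> measurable_fun setT f ->
  measurable_fun setT (fun w => c w *: f w).
Proof.
move=> mc /measurable_mxP mf; apply/measurable_mxP => i j.
under eq_fun do rewrite mxE.
exact: measurable_funM.
Qed.

Lemma measurable_mxN (m n : nat) (f : Omega -> 'M[R]_(m, n)) :
  measurable_fun setT f -> measurable_fun setT (fun w => - f w).
Proof.
move=> mf; under eq_fun do rewrite -scaleN1r.
exact: measurable_mxZ.
Qed.

Lemma measurable_mx_sum (m n : nat) (I : Type) (s : seq I)
    (f : I -> Omega -> 'M[R]_(m, n)) :
  (forall i, measurable_fun setT (f i)) ->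
  measurable_fun setT (fun w => \sum_(i <- s) f i w).
Proof.
move=> mf; apply/measurable_mxP => i j.
under eq_fun do rewrite summxE.
by apply: measurable_sum => l; exact: (measurable_mxP _).1.
Qed.

Lemma measurable_mulmx (m n q : nat) (f : Omega -> 'M[R]_(m, n))
    (g : Omega -> 'M[R]_(n, q)) :
  measurable_fun setT f -> measurable_fun setT g ->
  measurable_fun setT (fun w => f w *m g w).
Proof.
move=> /measurable_mxP mf /measurable_mxP mg; apply/measurable_mxP => i j.
under eq_fun do rewrite mxE.
by apply: measurable_sum => l; exact: measurable_funM.
Qed.

Lemma measurable_grad_perturb (m : nat) (y : bool) (g0 g1 : Omega -> 'rV[R]_m)
    (u : Omega -> R) :
  measurable_fun setT g0 -> measurable_fun setT g1 -> measurable_fun setT u ->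
  measurable_fun setT (fun w => grad_perturb y (g0 w) (g1 w) (u w)).
Proof.
move=> m0 m1 mu; rewrite /grad_perturb; case: y => /=;
  apply: measurable_mxD => //; apply: measurable_mxZ => //;
  apply: measurable_mxD => //; exact: measurable_mxN.
Qed.

End measurable_matrix_theory.

(** * Integration over the randomness independent of one noise *)

Section independent_noise.
Local Open Scope ereal_scope.
Context {R : realType} {dO dT : measure_display}.
Context {Omega : measurableType dO} {T : measurableType dT}.
Variables (P : {finite_measure set Omega -> \bar R}) (U : probability T R).
Variables (E : set Omega) (G : set (set Omega)) (N : Omega -> T).
Hypotheses (mE : measurable E) (setIG : setI_closed G) (GT : G setT).
Hypotheses (Gm : G `<=` measurable) (mN : measurable_fun setT N).
Hypothesis indepG : forall A Q, G A -> measurable Q ->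
  P (A `&` N @^-1` Q `&` E) = P (A `&` E) * U Q.

(** With [Q] fixed, both sides are finite measures in [A]: a restriction of [P], and a restriction
    scaled by the number [U Q]. They agree on the pi-system [G], hence on the sigma-algebra it
    generates. *)
Lemma independent_sigma_algebra A Q : <<s G >> A -> measurable Q ->
  P (A `&` N @^-1` Q `&` E) = P (A `&` E) * U Q.
Proof.
move=> sGA mQ.
have mNQ : measurable (N @^-1` Q) by rewrite -[_ @^-1` _]setTI; exact: mN.
have mNQE : measurable (N @^-1` Q `&` E) by exact: measurableI.
have UQ : U Q \is a fin_num by exact: fin_num_measure.
have UQ0 : (0 <= fine (U Q))%R by rewrite fine_ge0.
pose c := NngNum UQ0.
have restrE B : mrestr P mNQE B = P (B `&` N @^-1` Q `&` E).
  by rewrite /mrestr setIA.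
have scaleE B : mscale c (mrestr P mE) B = P (B `&` E) * U Q.
  by rewrite /mscale /mrestr /= fineK// muleC.
rewrite -restrE -scaleE.
(* The constant sequence [setT] serves as the cover by members of [G] of finite measure. *)
apply: (@g_sigma_algebra_measure_unique _ R Omega G Gm (fun=> setT)) => //.
- by rewrite -subTset => x _; exists 0%N.
- by move=> B GB; rewrite [LHS]restrE [RHS]scaleE indepG.
- by move=> n; rewrite ltey_eq fin_num_measure.
Qed.

Let mid : measurable_fun setT (id : Omega -> g_sigma_algebraType G).
Proof.
move=> _ A mA; rewrite setTI.
exact: (smallest_sub (@sigma_algebra_measurable _ Omega) Gm).
Qed.

Let mpair : measurable_fun setT
  (fun w : Omega => (w : g_sigma_algebraType G, N w)).
Proof. exact: measurable_fun_pair. Qed.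

Let nu := pushforward (mrestr P mE) (id : Omega -> g_sigma_algebraType G).

Let nu0 : nu set0 = 0. Proof. exact: measure0. Qed.
Let nu_ge0 A : 0 <= nu A. Proof. exact: measure_ge0. Qed.
Let nu_sigma_additive : semi_sigma_additive nu.
Proof. exact: measure_semi_sigma_additive. Qed.

HB.instance Definition _ :=
  isMeasure.Build _ _ _ nu nu0 nu_ge0 nu_sigma_additive.

Let nu_fin : fin_num_fun nu.
Proof.
by move=> A mA; apply: fin_num_measure; rewrite -[A]setTI; exact: mid.
Qed.

HB.instance Definition _ := @Measure_isFinite.Build _ _ _ nu nu_fin.

Let joint := pushforward (mrestr P mE)
  (fun w : Omega => (w : g_sigma_algebraType G, N w)).

Let joint0 : joint set0 = 0. Proof. exact: measure0. Qed.
Let joint_ge0 A : 0 <= joint A. Proof. exact: measure_ge0. Qed.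
Let joint_sigma_additive : semi_sigma_additive joint.
Proof. exact: measure_semi_sigma_additive. Qed.

HB.instance Definition _ :=
  isMeasure.Build _ _ _ joint joint0 joint_ge0 joint_sigma_additive.

(** Independence makes [joint] agree with the product of [nu] and [U] on rectangles, so the two
    measures coincide and [joint] is computed by sections. *)
Let jointE C : measurable C -> joint C = \int[nu]_w U (xsection C w).
Proof.
move=> mC; rewrite -(@product_measure_unique _ _ _ _ _ nu U joint)//.
by move=> A Q mA mQ; exact: independent_sigma_algebra.
Qed.

Lemma le_measure_independent_noise (c : R)
    (C C' : set (g_sigma_algebraType G * T)) :
  (0 <= c)%R -> measurable C -> measurable C' ->
  (forall w, U [set a | C (w, a)] <= c%:E * U [set a | C' (w, a)]) ->
  P ([set w | C (w, N w)] `&` E) <= c%:E * P ([set w | C' (w, N w)] `&` E).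
Proof.
move=> c0 mC mC' CC'.
rewrite -[leLHS]/(joint C) -[P _]/(joint C') !jointE//.
rewrite -ge0_integralZl//; last exact: measurable_fun_xsection.
apply: ge0_le_integral => //.
- exact: measurable_fun_xsection.
- by apply: measurable_funeM; exact: measurable_fun_xsection.
- by move=> w _; rewrite !xsectionE; exact: CC'.
Qed.

End independent_noise.

(** * Runs with fixed batches and arbitrary answers to the calls *)

Section run.
Context {R : realType} {X : Type} {d pN pL k B : nat}.
Variables (model : split_model R X d pN pL) (c : R) (xs : 'I_B -> 'I_k -> X).

Let state : Type := ('rV[R]_pN * 'rV[R]_pL)%type.

(* The call [false] of a sample perturbs the derivative in the embedding, which
   is sent; the call [true] perturbs the derivative in [theta_L]. *)
Definition call_dim (t : bool) : nat := if t then pL else d.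

Definition loss_gradient (t : bool) :
    'rV[R]_pL -> 'rV[R]_d -> bool -> 'rV[R]_(call_dim t) :=
  if t return 'rV[R]_pL -> 'rV[R]_d -> bool -> 'rV[R]_(call_dim t)
  then dloss_dtheta model else dloss_de model.

(** An arbitrary answer to each call, so that a run in which one answer is prescribed is again a
    run. *)
Definition perturbation : Type := 'I_B -> 'I_k -> forall t : bool,
  'rV[R]_(call_dim t) -> 'rV[R]_(call_dim t) -> 'rV[R]_(call_dim t).

Definition run_embedding (b : 'I_B) (th : state) (i : 'I_k) : 'rV[R]_d :=
  embed model th.1 (xs b i).

Definition run_call (p : perturbation) (b : 'I_B) (th : state) (i : 'I_k)
    (t : bool) : 'rV[R]_(call_dim t) :=
  let g := loss_gradient t th.2 (run_embedding b th i) in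
  p b i t (g false) (g true).

Definition run_update (p : perturbation) (th : state) (b : 'I_B) : state :=
  (th.1 - c *:
     \sum_i (run_call p b th i false : 'rV[R]_d) *m
       dembed_dtheta model th.1 (xs b i),
   th.2 - c *: \sum_i (run_call p b th i true : 'rV[R]_pL)).

Definition run_state (p : perturbation) (th : state) (j : nat) : state :=
  foldl (run_update p) th (take j (enum 'I_B)).

Definition run_transcript (p : perturbation) (th : state)
    : B.-tuple (k.-tuple 'rV[R]_d * k.-tuple 'rV[R]_d)%type :=
  [tuple ([tuple run_embedding b (run_state p th b) i | i < k],
          [tuple (run_call p b (run_state p th b) i false : 'rV[R]_d)
          | i < k]) | b < B].

(** The label depends on [t] too: in a hybrid run the two calls of one sample use different
    labels. *)
Definition label_perturbation (y : 'I_B -> 'I_k -> bool -> bool)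
    (u : 'I_B -> 'I_k -> bool -> R) : perturbation :=
  fun b i t g0 g1 => grad_perturb (y b i t) g0 g1 (u b i t).

(** Agreement is required only along the run of [p]: by induction the run of [q] has visited the
    same states so far, and only calls of earlier batches have been made. *)
Lemma run_state_local (p q : perturbation) (th : state) (j : nat) :
  (forall (b : 'I_B) i t, (b < j)%N ->
    run_call p b (run_state p th b) i t =
    run_call q b (run_state p th b) i t) ->
  run_state q th j = run_state p th j.
Proof.
rewrite /run_state; elim: j => [|j IHj] pq; first by rewrite !take0.
(* Beyond the last batch the list taken no longer grows, and the induction hypothesis is already the
   claim. *)
have [jB|Bj] := ltnP j B; last first.
  have tB l : (B <= l)%N -> take l (enum 'I_B) = take j (enum 'I_B).
    by move=> Bl; rewrite !take_oversize ?size_enum_ord.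
  rewrite (tB j.+1) ?leqW// IHj// => b i t bj; exact/pq/ltnW.
rewrite (take_nth (Ordinal jB)) ?size_enum_ord// -!cats1 !foldl_cat /=.
rewrite IHj => [|b i t bj]; last exact/pq/ltnW.
rewrite (nth_ord_enum _ (Ordinal jB)).
set b := Ordinal jB; set st := foldl _ _ _.
have qE i t : run_call q b st i t = run_call p b st i t by rewrite pq /=.
by rewrite /run_update; congr (_ - _ *: _, _ - _ *: _);
  apply: eq_bigr => i _; rewrite qE.
Qed.

Lemma run_transcript_local (p q : perturbation) (th : state) :
  (forall b i t,
    run_call p b (run_state p th b) i t =
    run_call q b (run_state p th b) i t) ->
  run_transcript q th = run_transcript p th.
Proof.
move=> pq; apply/eq_from_tnth => b; rewrite !tnth_mktuple.
have -> : run_state q th b = run_state p th b by exact: run_state_local.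
by congr pair; apply/eq_from_tnth => i; rewrite !tnth_mktuple// -pq.
Qed.

Lemma measurable_loss_gradient t j :
  measurable_fun setT (fun te : 'rV[R]_pL * 'rV[R]_d =>
    loss_gradient t te.1 te.2 j).
Proof.
by case: t; [exact: measurable_dloss_dtheta|exact: measurable_dloss_de].
Qed.

Context {dO : measure_display} {Omega : measurableType dO}.

(** The gradients vary with [w] as well, since in a run they depend on earlier noises. *)
Definition measurable_perturbation (p : Omega -> perturbation) : Prop :=
  forall b i t (g0 g1 : Omega -> 'rV[R]_(call_dim t)),
    measurable_fun setT g0 -> measurable_fun setT g1 ->
    measurable_fun setT (fun w => p w b i t (g0 w) (g1 w)).

Variables (p : Omega -> perturbation) (th0 : Omega -> state).
Hypotheses (mp : measurable_perturbation p) (mth0 : measurable_fun setT th0).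

Lemma measurable_run_embedding b i (th : Omega -> state) :
  measurable_fun setT th ->
  measurable_fun setT (fun w => run_embedding b (th w) i).
Proof.
move=> /measurable_fun_pairP[mth _].
exact: (measurableT_comp (measurable_embed model (xs b i)) mth).
Qed.

Lemma measurable_run_call b i t (th : Omega -> state) :
  measurable_fun setT th ->
  measurable_fun setT (fun w => run_call (p w) b (th w) i t).
Proof.
move=> mth; have me := @measurable_run_embedding b i _ mth.
have [_ mth2] := (measurable_fun_pairP _).1 mth.
have mg j := measurableT_comp (@measurable_loss_gradient t j)
  (measurable_fun_pair mth2 me).
exact: (mp b i (mg false) (mg true)).
Qed.

Lemma measurable_run_update b (th : Omega -> state) :
  measurable_fun setT th ->
  measurable_fun setT (fun w => run_update (p w) (th w) b).
Proof.
move=> mth; have [mth1 mth2] := (measurable_fun_pairP _).1 mth.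
apply: measurable_fun_pair; apply: measurable_mxD => //;
  apply: measurable_mxN; apply: measurable_mxZ => //;
  apply: measurable_mx_sum => i.
  apply: measurable_mulmx; first exact: (@measurable_run_call b i false _ _).
  exact: (measurableT_comp (measurable_dembed_dtheta model (xs b i)) mth1).
exact: (@measurable_run_call b i true _ _).
Qed.

Lemma measurable_run_state j :
  measurable_fun setT (fun w => run_state (p w) (th0 w) j).
Proof.
(* Induction from the right end of the list, because [foldl] applies the last update outermost. *)
rewrite /run_state; elim/last_ind: (take _ _) => [|s b IHs] //.
under eq_fun do rewrite -cats1 foldl_cat /=.
exact: measurable_run_update.
Qed.

Lemma measurable_run_transcript :
  measurable_fun setT (fun w => run_transcript (p w) (th0 w)).
Proof.
apply/measurable_fun_tnthP => b.
rewrite [X in measurable_fun _ X](_ : _ = fun w =>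
  ([tuple run_embedding b (run_state (p w) (th0 w) b) i | i < k],
   [tuple (run_call (p w) b (run_state (p w) (th0 w) b) i false : 'rV[R]_d)
   | i < k])); last by apply/funext => w /=; rewrite tnth_mktuple.
have ms := measurable_run_state b.
apply: measurable_fun_pair; apply/measurable_fun_tnthP => i.
- rewrite [X in measurable_fun _ X](_ : _ = fun w =>
    run_embedding b (run_state (p w) (th0 w) b) i).
    exact: measurable_run_embedding.
  by apply/funext => w /=; rewrite tnth_mktuple.
- rewrite [X in measurable_fun _ X](_ : _ = fun w =>
    run_call (p w) b (run_state (p w) (th0 w) b) i false : 'rV[R]_d).
    exact: (@measurable_run_call b i false _ _).
  by apply/funext => w /=; rewrite tnth_mktuple.
Qed.

End run.

(** * Independence of one noise from all the others and the initialization *)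

Section tpsl_noise.
Context {R : realType} {X : Type} {pN pL n B : nat}.
Context {dO : measure_display} {Omega : measurableType dO}.
Context {P : probability Omega R} {U : probability R R}.
Variable rnd : tpsl_randomness X pN pL n B P U.

Let k := (n %/ B)%N.

Definition noise (w : Omega) (b : 'I_B) (i : 'I_k) (t : bool) : R :=
  if t then noise_u rnd b i w else noise_g rnd b i w.

Lemma measurable_noise b i t : measurable_fun setT (fun w => noise w b i t).
Proof. by rewrite /noise; case: t; exact: measurable_funPT. Qed.

Variables (x : n.-tuple X) (s : {ffun 'I_B * 'I_k -> 'I_n}).
Variables (b0 : 'I_B) (i0 : 'I_k) (t0 : bool).

(* A full side at [(b0, i0, t0)] leaves that noise unconstrained. *)
Definition other_noise_sets : set (set Omega) :=
  [set E | exists (A : set ('rV[R]_pN * 'rV[R]_pL)%type)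
      (S : 'I_B -> 'I_k -> bool -> set R),
    [/\ measurable A, forall b i t, measurable (S b i t), S b0 i0 t0 = setT &
      E = [set w | A (theta_init rnd w) /\
        forall b i t, S b i t (noise w b i t)]]].

Lemma noise_rectangle (A : set ('rV[R]_pN * 'rV[R]_pL)%type)
    (S : 'I_B -> 'I_k -> bool -> set R) :
  measurable A -> (forall b i t, measurable (S b i t)) ->
  (P ([set w | A (theta_init rnd w) /\ forall b i t, S b i t (noise w b i t)]
    `&` [set w | batch rnd x w = s]) =
  P [set w | batch rnd x w = s /\ A (theta_init rnd w)] *
    \prod_(b < B) \prod_(i < k) (U (S b i false) * U (S b i true)))%E.
Proof.
move=> mA mS.
rewrite -(noise_indep rnd x s (Sg := fun b i => S b i false)
  (Su := fun b i => S b i true))//.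
congr (P _); apply/seteqP; split=> w /=.
  by move=> [[Aw Sw] sw].
by move=> [sw Aw Sw]; split=> //; split=> // b i [|]; have [] := Sw b i.
Qed.

(** The side of [E] at the chosen call is full, so imposing [Q] there gives another rectangle, in
    which the factor [U setT], equal to 1, becomes [U Q]. *)
Lemma noise_independent (E : set Omega) (Q : set R) :
  other_noise_sets E -> measurable Q ->
  (P (E `&` (fun w => noise w b0 i0 t0) @^-1` Q `&`
    [set w | batch rnd x w = s]) =
  P (E `&` [set w | batch rnd x w = s]) * U Q)%E.
Proof.
move=> [A [S [mA mS S0 ->]]] mQ.
pose S' b i t := if (b, i, t) == (b0, i0, t0) then Q else S b i t.
have mS' b i t : measurable (S' b i t) by rewrite /S'; case: ifP.
have -> : [set w | A (theta_init rnd w) /\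
      forall b i t, S b i t (noise w b i t)]
    `&` (fun w => noise w b0 i0 t0) @^-1` Q =
    [set w | A (theta_init rnd w) /\ forall b i t, S' b i t (noise w b i t)].
  apply/seteqP; split=> w /=.
    move=> [[Aw Sw] Qw]; split=> // b i t; rewrite /S'.
    by case: eqP => [[-> -> ->]|].
  move=> [Aw Sw]; have := Sw b0 i0 t0; rewrite /S' eqxx => Qw; split=> //.
  split=> // b i t; have := Sw b i t; rewrite /S'.
  by case: eqP => [[-> -> ->]|]; rewrite ?S0.
rewrite !noise_rectangle// -muleA; congr (_ * _)%E.
(* The factor of the pair [(b0, i0)] is isolated in both products; all other factors are equal. *)
rewrite (bigD1 b0)//= (bigD1 i0)//= [in RHS](bigD1 b0)//= [in RHS](bigD1 i0)//=.
have -> : (\prod_(b < B | b != b0) \prod_(i < k)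
      (U (S' b i false) * U (S' b i true)) =
    \prod_(b < B | b != b0) \prod_(i < k)
      (U (S b i false) * U (S b i true)))%E.
  apply: eq_bigr => b bb0; apply: eq_bigr => i _; rewrite /S' !xpair_eqE.
  by rewrite (negPf bb0).
have -> : (\prod_(i < k | i != i0) (U (S' b0 i false) * U (S' b0 i true))
    = \prod_(i < k | i != i0) (U (S b0 i false) * U (S b0 i true)))%E.
  apply: eq_bigr => i ii0; rewrite /S' !xpair_eqE.
  by rewrite (negPf ii0) andbF.
have -> : (U (S' b0 i0 false) * U (S' b0 i0 true) =
    U Q * (U (S b0 i0 false) * U (S b0 i0 true)))%E.
  rewrite /S' !xpair_eqE !eqxx /=; case: t0 S0 => /= ->;
  by rewrite probability_setT ?mule1 ?mul1e// muleC.
by rewrite -!muleA muleC -!muleA.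
Qed.

Lemma other_noise_sets_setI : setI_closed other_noise_sets.
Proof.
move=> _ _ [A [S [mA mS S0 ->]]] [A' [S' [mA' mS' S0' ->]]].
exists (A `&` A'), (fun b i t => S b i t `&` S' b i t); split.
- exact: measurableI.
- by move=> b i t; exact: measurableI.
- by rewrite S0 S0' setIT.
- apply/seteqP; split=> w /=.
    by move=> [[Aw Sw] [Aw' Sw']]; split=> // b i t; split.
  by move=> [[Aw Aw'] Sw]; split; split=> // b i t; have [] := Sw b i t.
Qed.

Lemma other_noise_sets_setT : other_noise_sets setT.
Proof.
exists setT, (fun _ _ _ => setT); split=> //.
by apply/seteqP; split.
Qed.

Lemma measurable_other_noise_theta :
  measurable_fun setT
    (fun w : g_sigma_algebraType other_noise_sets => theta_init rnd w).
Proof.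
move=> _ A mA; rewrite setTI; apply: sub_sigma_algebra.
exists A, (fun _ _ _ => setT); split=> //.
by apply/seteqP; split=> w //= [].
Qed.

Lemma measurable_other_noise b i t : (b, i, t) != (b0, i0, t0) ->
  measurable_fun setT
    (fun w : g_sigma_algebraType other_noise_sets => noise w b i t).
Proof.
move=> bit _ A mA; rewrite setTI; apply: sub_sigma_algebra.
exists setT, (fun b' i' t' => if (b', i', t') == (b, i, t) then A else setT).
split=> //.
- by move=> b' i' t'; case: ifP.
- by rewrite eq_sym (negPf bit).
- apply/seteqP; split=> w /=.
    by move=> Aw; split=> // b' i' t'; case: eqP => [[-> -> ->]|].
  by move=> [_ /(_ b i t)]; rewrite eqxx.
Qed.

Lemma other_noise_sets_measurable : other_noise_sets `<=` measurable.
Proof.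
move=> _ [A [S [mA mS _ ->]]].
have -> : [set w | A (theta_init rnd w) /\
      forall b i t, S b i t (noise w b i t)]
  = theta_init rnd @^-1` A `&`
    \bigcap_(j in [set: 'I_B * 'I_k * bool])
      ((fun w => noise w j.1.1 j.1.2 j.2) @^-1` S j.1.1 j.1.2 j.2).
  apply/seteqP; split=> w /=.
    by move=> [Aw Sw]; split=> // j _; exact: Sw.
  by move=> [Aw Sw]; split=> // b i t; exact: (Sw (b, i, t)).
apply: measurableI.
  by rewrite -[_ @^-1` _]setTI; exact: measurable_funPT.
apply: fin_bigcap_measurable => // j _.
by rewrite -[_ @^-1` _]setTI; exact: measurable_noise.
Qed.

End tpsl_noise.

(** * Switching the labels one call at a time *)

Section hybrid.
Context {R : realType} {X : Type} {d pN pL n B : nat}.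
Context {dO : measure_display} {Omega : measurableType dO}.
Context {P : probability Omega R} {U : probability R R}.
Variables (eps : R) (hU : grad_perturb_label_dp U eps).
Variables (model : split_model R X d pN pL) (eta : R).
Variable rnd : tpsl_randomness X pN pL n B P U.
Variables (x : n.-tuple X) (s : {ffun 'I_B * 'I_(n %/ B) -> 'I_n}).

Let k := (n %/ B)%N.
Let xs (b : 'I_B) (i : 'I_k) : X := tnth x (s (b, i)).
Let c : R := eta * (B%:R / n%:R).

Definition labelled_run (y : 'I_B -> 'I_k -> bool -> bool)
    (u : 'I_B -> 'I_k -> bool -> R) (th : 'rV[R]_pN * 'rV[R]_pL) :=
  run_transcript model c xs (label_perturbation y u) th.

Definition set_noise (u : 'I_B -> 'I_k -> bool -> R) b0 i0 t0 (a : R) :=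
  fun b i t => if (b, i, t) == (b0, i0, t0) then a else u b i t.

Lemma le_labelled_run_noise (y y' : 'I_B -> 'I_k -> bool -> bool) u th
    b0 i0 t0 S :
  (forall b i t, (b, i, t) != (b0, i0, t0) -> y b i t = y' b i t) ->
  y b0 i0 t0 <> y' b0 i0 t0 -> measurable S ->
  (U [set a | S (labelled_run y (set_noise u b0 i0 t0 a) th)] <=
  (expR eps)%:E *
    U [set a | S (labelled_run y' (set_noise u b0 i0 t0 a) th)])%E.
Proof.
move=> yy' yy0 mS.
(* [psi v] answers the chosen call by [v] and the others by GradPerturb. [dfwith] transports [v] to
   the dimension of [t]; its default 0 is never returned, since the test forces [t] to be [t0]. *)
pose psi (v : 'rV[R]_(@call_dim d pL t0)) : @perturbation R d pL k B :=
  fun b i t g0 g1 => if (b, i, t) == (b0, i0, t0)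
    then dfwith (fun t => 0 : 'rV[R]_(@call_dim d pL t)) t0 v t
    else grad_perturb (y b i t) g0 g1 (u b i t).
(* The answer 0 is arbitrary: the state before batch [b0] uses no answer from that batch. *)
pose st := run_state model c xs (psi 0) th b0.
pose g := loss_gradient model t0 st.2 (run_embedding model xs b0 st i0).
(* Stated for any [z] agreeing with [y] elsewhere, so that [y] and [y'] share the post-processing
   [psi] and the gradients [g]. *)
have runE z a :
    (forall b i t, (b, i, t) != (b0, i0, t0) -> y b i t = z b i t) ->
    labelled_run z (set_noise u b0 i0 t0 a) th =
    run_transcript model c xs
      (psi (grad_perturb (z b0 i0 t0) (g false) (g true) a)) th.
  move=> yz; pose q : @perturbation R d pL k B :=
    label_perturbation z (set_noise u b0 i0 t0 a).
  have qE v b th' i t : (b, i, t) != (b0, i0, t0) ->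
      run_call model xs q b th' i t = run_call model xs (psi v) b th' i t.
    move=> bit; rewrite /run_call /q /label_perturbation /psi /set_noise.
    by rewrite (negPf bit) yz.
  have qst : st = run_state model c xs q th b0.
    apply: run_state_local => b i t bb0; apply: qE.
    by apply: contraTneq bb0 => -[-> _ _]; rewrite ltnn.
  apply/esym/run_transcript_local => b i t.
  have [[-> -> ->]|] := eqVneq (b, i, t) (b0, i0, t0); last exact: qE.
  rewrite -qst /run_call /q /label_perturbation /psi /set_noise eqxx.
  by rewrite dfwithin.
pose S' := [set v | S (run_transcript model c xs (psi v) th)].
have mS' : measurable S'.
  rewrite -[S']setTI; apply: measurable_run_transcript => // b i t g0 g1 m0 m1.
  rewrite /psi; case: eqP => [_|_]; last exact: measurable_grad_perturb.
  have [tt0|tt0] := eqVneq t0 t.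
    (* Eliminating the equality identifies the two dimensions, after which [dfwith] returns [v]
       itself. *)
    case: t / tt0 g0 g1 m0 m1 => g0 g1 m0 m1.
    under eq_fun do rewrite dfwithin.
    exact: measurable_id.
  under eq_fun do rewrite dfwithout//.
  exact: measurable_cst.
have [_ /(_ _ _ yy0 S' mS')] := hU (g false) (g true).
rewrite adde0 => le_eps.
under [X in (U X <= _)%E]eq_set do rewrite runE//.
under [X in (_ <= _ * U X)%E]eq_set do rewrite runE//.
exact: le_eps.
Qed.

(** A joint probability with the event that the division is [s], not a conditional one, so that
    summing over [s] gives the law of the transcript. *)
Definition batch_run_law z S : \bar R :=
  P ([set w | S (labelled_run z (noise rnd w) (theta_init rnd w))]
    `&` [set w | batch rnd x w = s]).

Lemma le_batch_run_law (y y' : 'I_B -> 'I_k -> bool -> bool) b0 i0 t0 S :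
  (forall b i t, (b, i, t) != (b0, i0, t0) -> y b i t = y' b i t) ->
  y b0 i0 t0 <> y' b0 i0 t0 -> measurable S ->
  (batch_run_law y S <= (expR eps)%:E * batch_run_law y' S)%E.
Proof.
move=> yy' yy0 mS.
pose G := other_noise_sets rnd b0 i0 t0.
(* The chosen noise becomes a separate coordinate: [set_noise] overwrites its value in [wa.1], so
   only frozen randomness is read from there. *)
pose C z := [set wa : g_sigma_algebraType G * R |
  S (labelled_run z (set_noise (noise rnd wa.1) b0 i0 t0 wa.2)
    (theta_init rnd wa.1))].
have mC z : measurable (C z).
  rewrite -[C z]setTI; apply: measurable_run_transcript => //; last first.
    apply: (measurableT_comp _ measurable_fst).
    exact: measurable_other_noise_theta.
  move=> b i t g0 g1 m0 m1; apply: measurable_grad_perturb => //.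
  rewrite /set_noise; case: eqP => [_|/eqP bit]; first exact: measurable_snd.
  apply: (measurableT_comp
    (f := fun w : g_sigma_algebraType G => noise rnd w b i t)) => //.
  exact: measurable_other_noise.
have noiseE w : set_noise (noise rnd w) b0 i0 t0 (noise rnd w b0 i0 t0) =
    noise rnd w.
  apply/funext => b; apply/funext => i; apply/funext => t; rewrite /set_noise.
  by case: eqP => [[-> -> ->]|].
have CE z : [set w | S (labelled_run z (noise rnd w) (theta_init rnd w))] =
    [set w | C z (w, noise rnd w b0 i0 t0)].
  by apply/seteqP; split=> w; rewrite /C /= noiseE.
rewrite /batch_run_law (CE y) (CE y').
apply: (le_measure_independent_noise (U := U)
  (G := other_noise_sets rnd b0 i0 t0) (N := fun w => noise rnd w b0 i0 t0)).
- exact: measurable_batch.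
- exact: other_noise_sets_setI.
- exact: other_noise_sets_setT.
- exact: other_noise_sets_measurable.
- exact: measurable_noise.
- by move=> A Q GA mQ; exact: noise_independent.
- exact: expR_ge0.
- exact: mC.
- exact: mC.
- move=> w.
  exact: (le_labelled_run_noise (noise rnd w) (theta_init rnd w) yy' yy0 mS).
Qed.

Lemma le_batch_run_law_label (y y' : 'I_B -> 'I_k -> bool) b0 i0 S :
  (forall b i, (b, i) != (b0, i0) -> y b i = y' b i) ->
  y b0 i0 <> y' b0 i0 -> measurable S ->
  (batch_run_law (fun b i _ => y b i) S <=
  (expR (2 * eps))%:E * batch_run_law (fun b i _ => y' b i) S)%E.
Proof.
move=> yy' yy0 mS.
(* The hybrid: the gradient call already uses [y'], while the parameter call still uses [y]. *)
pose mid b i (t : bool) := if t then y b i else y' b i.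
apply: (le_trans (y := ((expR eps)%:E * batch_run_law mid S)%E)).
  apply: (@le_batch_run_law _ _ b0 i0 false) => // b i [|] // bi.
  by apply: yy'; apply: contraNneq bi => -[-> ->].
rewrite mulr_natl mulr2n expRD EFinM -muleA.
apply: lee_wpmul2l; first by rewrite lee_fin expR_ge0.
apply: (@le_batch_run_law _ _ b0 i0 true) => // b i [|] // bi.
by apply: yy'; apply: contraNneq bi => -[-> ->].
Qed.

End hybrid.

(** * Summation over the possible divisions into batches *)

Theorem lemma4p1 (R : realType) (eps : R) (heps : 0 < eps)
    (U : probability R R)
    (hU : grad_perturb_label_dp U eps)
    (X : Type) (n B d pN pL : nat) (hB : (B %| n)%N)
    (model : split_model R X d pN pL) (eta : R)
    (dO : measure_display) (Omega : measurableType dO)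
    (P : probability Omega R)
    (rnd : tpsl_randomness X pN pL n B P U) :
  differentially_private (@neighboring X n) P
    (tpsl_transcript model eta rnd) (2 * eps) 0.
Proof.
pose at_s (x : n.-tuple X) s := [set w | batch rnd x w = s].
pose lab (D : dataset X n) (s : {ffun 'I_B * 'I_(n %/ B) -> 'I_n})
  (b : 'I_B) (i : 'I_(n %/ B)) (_ : bool) := tnth (labels D) (s (b, i)).
have transcriptE D s w : at_s (features D) s w ->
    tpsl_transcript model eta rnd D w =
    labelled_run model eta (features D) s (lab D s) (noise rnd w)
      (theta_init rnd w).
  by move=> <-.
have mat_s x s : measurable (at_s x s) by exact: measurable_batch.
have mrun D s : measurable_fun setT (fun w =>
    labelled_run model eta (features D) s (lab D s) (noise rnd w)
      (theta_init rnd w)).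
  apply: measurable_run_transcript => // b i t g0 g1 m0 m1.
  by apply: measurable_grad_perturb => //; exact: measurable_noise.
pose part D S s := [set w | S (labelled_run model eta (features D) s (lab D s)
  (noise rnd w) (theta_init rnd w))] `&` at_s (features D) s.
have mpart D S s : measurable S -> measurable (part D S s).
  move=> mS; apply: measurableI => //.
  by rewrite -[X in measurable X]setTI; exact: mrun.
(* The division takes finitely many values, so the transcript event is a finite union of events with
   a fixed division. *)
have partE D S : tpsl_transcript model eta rnd D @^-1` S =
    \bigcup_(s in [set: {ffun 'I_B * 'I_(n %/ B) -> 'I_n}]) part D S s.
  apply/seteqP; split=> w /=.
    by move=> Sw; exists (batch rnd (features D) w) => //; split.
  by move=> [s _ [/= Sw sw]]; rewrite (transcriptE _ _ _ sw).
split=> [D _ S mS|D D' [xx' [j [yj yy']]] S mS].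
  by rewrite setTI partE; apply: fin_bigcup_measurable => // s _; exact: mpart.
have PE D1 : P (tpsl_transcript model eta rnd D1 @^-1` S) =
    (\sum_(s : {ffun 'I_B * 'I_(n %/ B) -> 'I_n})
      batch_run_law model eta rnd (features D1) s (lab D1 s) S)%E.
  rewrite partE measure_fin_bigcup//; last 3 first.
  - exact: finite_finset.
  - by move=> s1 s2 _ _ [w [[_ <-] [_ <-]]].
  - by move=> s _; exact: mpart.
  rewrite [RHS]fsbig_seq ?index_enum_uniq//; apply: eq_fsbigl.
  by apply/seteqP; split=> s //= _; rewrite mem_index_enum.
rewrite adde0 [leLHS]PE [X in (_ * X)%E]PE ge0_sume_distrr; last first.
  by move=> s _; exact: measure_ge0.
(* The features are equal, so both datasets have the same event at [s] and the sums compare term by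
   term. *)
apply: lee_sum => s _; rewrite -xx'.
(* A division is always bijective, so any other [s] contributes 0 to both sums. *)
have [[s' sK Ks]|nbij] := pselect (bijective s); last first.
  have at_s0 : at_s (features D) s = set0.
    apply/seteqP; split=> w //= sw; apply: nbij; rewrite -sw.
    exact: batch_bij.
  have law0 y : batch_run_law model eta rnd (features D) s y S = 0%E.
    by rewrite /batch_run_law -/(at_s _ _) at_s0 setI0 measure0.
  by rewrite !law0 mule0.
(* [(b, i)] is the only place where the sample [j] with the changed label is used, by injectivity of
   [s]. *)
case bi: (s' j) => [b i]; have sbi : s (b, i) = j by rewrite -bi Ks.
apply: (@le_batch_run_law_label _ _ _ _ _ _ _ _ _ _ _ _ hU model eta rnd
  (features D) s (fun b i => tnth (labels D) (s (b, i)))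
  (fun b i => tnth (labels D') (s (b, i))) b i S) => //; last by rewrite sbi.
move=> b1 i1 /eqP bi1; apply: yy' => sbi1; apply: bi1.
by rewrite -bi -sbi1 sK.
Qed.
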